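(* For every triple of positive integers $(\ell,m,n)$ with $m\ge n$ there exists a shiftable $(16\ell^2mn,\,4\ell n;\,3)$ Heffter space.
   Context: For integers $a\le b$, $[a,b]$ denotes the set of integers $x$ with $a\le x\le b$. A $(v,k;r)$ space is a resolvable $(v_r,b_k)$ configuration with $b=\frac{vr}{k}$: a point-block incidence structure $(V,\mathcal B)$ with $|V|=v$ points, each lying in exactly $r$ blocks, and $b$ blocks, each a subset of $V$ of size $k$, such that any two distinct points lie together in at most one block, and such that $\mathcal B$ can be partitioned into parallel classes, each of which is a partition of $V$. Equivalently, it is given by a collection (called a resolution) of $r$ mutually orthogonal partitions of a $v$-set $V$ into subsets of size $k$, where two partitions $\mathcal P,\mathcal Q$ of $V$ are orthogonal if every part of $\mathcal P$ has at most one element in common with every part of $\mathcal Q$. A half-set of $[-v,v]$ is a subset $V\subseteq[-v,v]$ such that $V$ and $-V$ form a partition of $[-v,v]\setminus\{0\}$. An integer $(v,k;r)$ Heffter space is a $(v,k;r)$ space whose point set is a half-set of $[-v,v]$ and each of whose blocks has elements summing to $0$ in $\mathbb Z$. It is called shiftable if $k$ is even and each block contains exactly $\frac{k}{2}$ positive elements. A shiftable Heffter space is always understood to be integer. *)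

(* Defs.v *)
From HB Require Import structures.
From mathcomp Require Export all_boot all_order all_algebra.
From mathcomp Require Export finmap.

Set Implicit Arguments.
Unset Strict Implicit.
Unset Printing Implicit Defensive.

Import Order.TTheory GRing.Theory Num.Theory.

Local Open Scope fset_scope.

(* Analogue for {fset T} of [partition] in finset. *)
Definition fpartition (T : choiceType) (P : {fset {fset T}}) (D : {fset T}) :
    bool :=
  [&& fcover P == D, trivIfset P & fset0 \notin P].

Section Spaces.
Variable T : choiceType.
Implicit Types (V : {fset T}) (B : {fset {fset T}}).

(* (v_r, b_k) configuration *)
Definition configuration (v r b k : nat) V B : Prop :=
  [/\ #|` V| = v,
      #|` B| = b,
      {in B, forall A : {fset T}, A `<=` V /\ #|` A| = k},
      {in V, forall x, #|` [fset A in B | x \in (A : {fset T})]| = r}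
    & {in V &, forall x y, x != y ->
        (#|` [fset A in B | (x \in (A : {fset T})) && (y \in A)]| <= 1)%N}].

Definition resolvable V B : Prop :=
  exists R : {fset {fset {fset T}}},
    fpartition R B /\ {in R, forall C, fpartition C V}.

(* The number of blocks is b = v r / k as an exact quotient. *)
Definition space (v k r : nat) V B : Prop :=
  (exists2 b : nat, (b * k = v * r)%N & configuration v r b k V B)
  /\ resolvable V B.

End Spaces.

Local Open Scope ring_scope.

Definition opp_fset (V : {fset int}) : {fset int} := [fset - x | x in V].

(* "V and -V partition [-v, v] \ {0}" is stated for the pair (V, -V):
   [fpartition [fset V; opp_fset V]] would also accept V = -V. *)
Definition half_set (v : nat) (V : {fset int}) : Prop :=
  [disjoint V & opp_fset V] /\
  V `|` opp_fset V =i [predD1 `[- v%:Z, v%:Z] & 0].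

Definition integer_heffter_space (v k r : nat) (V : {fset int})
    (B : {fset {fset int}}) : Prop :=
  [/\ space v k r V B,
      half_set v V
    & {in B, forall A : {fset int}, \sum_(x <- A) x = 0}].

Definition shiftable_heffter_space (v k r : nat) (V : {fset int})
    (B : {fset {fset int}}) : Prop :=
  [/\ integer_heffter_space v k r V B,
      ~~ odd k
    & {in B, forall A : {fset int}, #|` [fset x in A | 0 < x]| = k./2}].

(* Main.v *)
(* Writing M = l m and N = l n, one needs a (16 M N, 4 N; 3) space. It is the
   product of a shiftable (16, 4; 3) space, namely a 4 x 4 array whose rows,
   columns and cyclic diagonals have sum 0 and two positive entries, with an
   arbitrary resolvable (M N, N; 3) configuration whose points are numbered
   0, ..., M N - 1: the point x of the array is shifted away from 0 by 16 w in
   the copy attached to the point number w. As the signs in each block of the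
   array cancel, the shifts do not change the block sums. The (M N, N; 3)
   configurations come from the addition table of Z/M if N = M, and from three
   slopes over Z/M if N < M. *)
Require Import Defs.
From mathcomp Require Import all_boot all_order all_algebra.
From mathcomp Require Import finmap.
From mathcomp Require Import zify.

Set Implicit Arguments.
Unset Strict Implicit.
Unset Printing Implicit Defensive.

Import Order.TTheory GRing.Theory Num.Theory.

Local Open Scope fset_scope.
Local Open Scope nat_scope.

(* [f c p] is the name of the part containing [p] in the [c]-th partition. *)
Definition orthogonal_partitions (P T : finType) (k r : nat)
    (f : 'I_r -> P -> T) : Prop :=
  (forall c t, #|[pred p | f c p == t]| = k) /\
  (forall c d, c != d -> injective (fun p => (f c p, f d p))).

Lemma injective_pair_sym (P T : finType) (r : nat) (f : 'I_r -> P -> T) :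
  (forall c d : 'I_r, c < d -> injective (fun p => (f c p, f d p))) ->
  forall c d, c != d -> injective (fun p => (f c p, f d p)).
Proof.
move=> inj_f c d neq_cd; have [lt_cd|lt_dc|/val_inj eq_cd] := ltngtP c d.
- exact: inj_f.
- by move=> p q [ec ed]; apply: (inj_f _ _ lt_dc); rewrite ec ed.
- by rewrite eq_cd eqxx in neq_cd.
Qed.

Lemma big_imfset_finType (R : Type) (idx : R) (op : Monoid.com_law idx)
    (P : finType) (X : choiceType) (lab : P -> X) (Q : simpl_pred P) (G : X -> R) :
  injective lab ->
  \big[op/idx]_(x <- [fset lab p | p in Q]) G x =
  \big[op/idx]_(p | Q p) G (lab p).
Proof.
move=> lab_inj; rewrite big_imfset /=; last by move=> ? ? _ _ /lab_inj.
by rewrite big_enum.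
Qed.

(** * Resolvable configurations from orthogonal partitions *)

Section SpaceOfPartitions.
Variables (P T : finType) (X : choiceType) (k r : nat).
Variables (f : 'I_r -> P -> T) (lab : P -> X).

Definition points : {fset X} := [fset lab p | p in predT].
Definition block (c : 'I_r) (t : T) : {fset X} :=
  [fset lab p | p in [pred p | f c p == t]].
Definition parallel_class (c : 'I_r) : {fset {fset X}} :=
  [fset block c t | t in predT].
Definition blocks : {fset {fset X}} :=
  [fset block z.1 z.2 | z in predT].
Definition resolution : {fset {fset {fset X}}} :=
  [fset parallel_class c | c in predT].

Hypothesis lab_inj : injective lab.
Hypothesis f_orth : orthogonal_partitions k f.
Hypothesis k_gt1 : 1 < k.
Hypothesis T_gt0 : 0 < #|T|.

Lemma in_block c t p : (lab p \in block c t) = (f c p == t).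
Proof.
apply/imfsetP/idP => [[q /= + /lab_inj ->] //|fp].
by exists p.
Qed.

Lemma blockP c t x : reflect (exists2 p, f c p = t & x = lab p) (x \in block c t).
Proof.
apply: (iffP idP) => [/imfsetP[p /= /eqP fp ->]|[p fp ->]]; first by exists p.
by rewrite in_block fp.
Qed.

Lemma pointsP x : reflect (exists p, x = lab p) (x \in points).
Proof.
apply: (iffP idP) => [/imfsetP[p _ ->]|[p ->]]; first by exists p.
by apply/imfsetP; exists p.
Qed.

Lemma parallel_classP c A : reflect (exists t, A = block c t) (A \in parallel_class c).
Proof.
apply: (iffP idP) => [/imfsetP[t _ ->]|[t ->]]; first by exists t.
by apply/imfsetP; exists t.
Qed.

Lemma blocksP A : reflect (exists c t, A = block c t) (A \in blocks).
Proof.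
apply: (iffP idP) => [/imfsetP[[c t] _ ->]|[c [t ->]]]; first by exists c, t.
by apply/imfsetP; exists (c, t).
Qed.

Lemma resolutionP C : reflect (exists c, C = parallel_class c) (C \in resolution).
Proof.
apply: (iffP idP) => [/imfsetP[c _ ->]|[c ->]]; first by exists c.
by apply/imfsetP; exists c.
Qed.

Lemma card_points : #|` points| = #|P|.
Proof. by rewrite /points card_fset_sum1 big_imfset_finType // sum1_card. Qed.

Lemma card_block c t : #|` block c t| = k.
Proof. by rewrite /block card_fset_sum1 big_imfset_finType // sum1_card f_orth.1. Qed.

Lemma block_nonempty c t : exists p, f c p = t.
Proof.
have: 0 < #|` block c t| by rewrite card_block ltnW.
by rewrite cardfs_gt0 => /fset0Pn[x /blockP[p fp _]]; exists p.
Qed.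

(** If [c] and [d] differed, any two points of the common block would agree in both partitions and
    so coincide, against [1 < k]. Hence blocks can be counted by the pairs [(c, t)], and distinct
    parallel classes share no block. *)
Lemma block_inj c t d u : block c t = block d u -> c = d /\ t = u.
Proof.
move=> eq_b; have eq_cd : c = d.
  apply/eqP; apply: contraTT k_gt1 => neq_cd; rewrite -leqNgt -(f_orth.1 c t).
  apply/card_le1P => p; rewrite inE => /eqP fp q; rewrite !inE.
  apply/eqP/eqP => [fq|->//]; apply: (f_orth.2 _ _ neq_cd); rewrite fp fq /=.
  have /eqP-> : f d p == u by rewrite -in_block -eq_b in_block fp.
  by have /eqP-> : f d q == u by rewrite -in_block -eq_b in_block fq.
split=> //; subst d; have [p fp] := block_nonempty c t.
by apply/eqP; rewrite -fp -in_block -eq_b in_block fp.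
Qed.

(** Two blocks through both points either come from one partition, where a single point already
    determines the block, or from two partitions, which orthogonality excludes. *)
Lemma common_blocks_le1 x y : x != y ->
  #|` [fset A in blocks | (x \in (A : {fset X})) && (y \in A)]| <= 1.
Proof.
move=> neq_xy; set S := [fset A in _ | _].
have SP A B : A \in S -> B \in S -> A = B.
  rewrite !inE /= => /and3P[/blocksP[c [t ->]] /blockP[p fp ex] /blockP[q fq ey]].
  move=> /and3P[/blocksP[d [u ->]]].
  move: neq_xy; rewrite {}ex {}ey !in_block => neq_pq /eqP fp' /eqP fq'.
  have eq_cd : c = d.
    apply/eqP; apply: contraNT neq_pq => neq_cd; apply/eqP; congr lab.
    by apply: (f_orth.2 _ _ neq_cd); rewrite fp fq fp' fq'.
  by subst d; rewrite -fp -fp'.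
have [->|[A AS]] := fset_0Vmem S; first by rewrite cardfs0.
apply: leq_trans (fsubset_leq_card _) (_ : #|` [fset A]| <= 1).
  by apply/fsubsetP => B BS; rewrite inE (SP _ _ BS AS).
by rewrite cardfs1.
Qed.

Lemma card_blocks_at x : x \in points ->
  #|` [fset A in blocks | x \in (A : {fset X})]| = r.
Proof.
case/pointsP=> p ->.
(* Each partition contributes the one block through [p], and [block_inj] keeps these distinct. *)
have -> : [fset A in blocks | lab p \in (A : {fset X})] =
    [fset block c (f c p) | c in predT].
  apply/fsetP => A; rewrite !inE /=; apply/andP/imfsetP => /=.
    by move=> [/blocksP[c [t ->]]]; rewrite in_block => /eqP <-; exists c.
  by move=> [c _ ->]; rewrite in_block; split=> //; apply/blocksP; exists c, (f c p).
rewrite card_fset_sum1 big_imfset_finType; last by move=> c d /block_inj[].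
by rewrite sum1_card card_ord.
Qed.

Lemma parallel_class_partition c : fpartition (parallel_class c) points.
Proof.
apply/and3P; split.
- apply/eqP/fsetP => x; apply/bigfcupP/pointsP => /=.
    by move=> [A /andP[/parallel_classP[t ->] _]] /blockP[p _ ->]; exists p.
  move=> [p ->]; exists (block c (f c p)); last by rewrite in_block.
  by rewrite andbT; apply/parallel_classP; exists (f c p).
- apply/trivIfsetP => _ _ /parallel_classP[t ->] /parallel_classP[u ->] neq_tu.
  apply/fdisjointP => x /blockP[p fp ->]; rewrite in_block fp.
  by apply: contraNN neq_tu => /eqP ->.
- apply/negP => /parallel_classP[t /esym t0].
  by have := ltnW k_gt1; rewrite -(card_block c t) t0 cardfs0.
Qed.

Lemma resolution_partition : fpartition resolution blocks.
Proof.
apply/and3P; split.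
- apply/eqP/fsetP => A; apply/bigfcupP/blocksP => /=.
    move=> [C /andP[/resolutionP[c ->] _]] /parallel_classP[t ->].
    by exists c, t.
  move=> [c [t ->]]; exists (parallel_class c).
    by rewrite andbT; apply/resolutionP; exists c.
  by apply/parallel_classP; exists t.
- apply/trivIfsetP => _ _ /resolutionP[c ->] /resolutionP[d ->] neq_cd.
  apply/fdisjointP => A /parallel_classP[t ->]; apply: contraNN neq_cd.
  by move=> /parallel_classP[u /block_inj[-> _]].
- apply/negP => /resolutionP[c /esym c0].
  have /card_gt0P[t _] := T_gt0.
  have: block c t \in parallel_class c by apply/parallel_classP; exists t.
  by rewrite c0 inE.
Qed.

Lemma card_partition (c : 'I_r) : #|P| = #|T| * k.
Proof.
rewrite -sum1_card (partition_big (f c) predT) //=.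
rewrite (eq_bigr (fun=> k)) ?sum_nat_const // => t _.
by rewrite -(f_orth.1 c t) -sum1_card; apply: eq_bigl => p; rewrite !inE.
Qed.

Lemma space_of_partitions : 0 < r -> Defs.space #|P| k r points blocks.
Proof.
move=> r_gt0; split; last first.
  exists resolution; split; first exact: resolution_partition.
  by move=> _ /resolutionP[c ->]; exact: parallel_class_partition.
exists (r * #|T|); first by rewrite (card_partition (Ordinal r_gt0)); lia.
split.
- exact: card_points.
- rewrite card_fset_sum1 big_imfset_finType.
    by rewrite sum1_card card_prod card_ord.
  by move=> [c t] [d u] /= /block_inj[-> ->].
- move=> _ /blocksP[c [t ->]]; split; last exact: card_block.
  by apply/fsubsetP => x /blockP[p _ ->]; apply/pointsP; exists p.
- exact: card_blocks_at.
- by move=> x y _ _; exact: common_blocks_le1.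
Qed.

End SpaceOfPartitions.

(** * Half-sets and balanced signs *)

(** Lowered by one, the absolute values inject [P] into ['I_v], which has the same size, so each of
    1, ..., v is the absolute value of some label. *)
Lemma half_set_of_abs_inj (P : finType) (lab : P -> int) (v : nat) :
  #|P| = v ->
  injective (fun p => `|lab p|%N) -> (forall p, 0 < `|lab p|%N <= v) ->
  half_set v (points lab).
Proof.
move=> card_P abs_inj abs_bd; split.
  apply/fdisjointP => _ /pointsP[p ->]; apply/negP.
  move=> /imfsetP[x /= /pointsP[q ->] e].
  have epq : p = q by apply: abs_inj; rewrite e abszN.
  by have := abs_bd p; move: e; rewrite epq; lia.
move=> x; rewrite [RHS]inE /= in_itv /= in_fsetU; apply/orP/idP.
  by case=> [/pointsP[p ->]|/imfsetP[y /= /pointsP[p ->] ->]];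
    have := abs_bd p; lia.
move=> /and3P[x0 xlo xhi].
have abs_lt p : `|lab p|%N.-1 < v by have := abs_bd p; lia.
have g_inj : injective (fun p => Ordinal (abs_lt p)).
  move=> p q [e]; apply: abs_inj; have := abs_bd p; have := abs_bd q; lia.
have card_le : #|'I_v| <= #|P| by rewrite card_ord card_P.
have x_lt : `|x|%N.-1 < v by lia.
have /codomP[p [ep]] := inj_card_onto g_inj card_le (Ordinal x_lt).
have {ep} : x = lab p \/ x = (- lab p)%R by have := abs_bd p; lia.
case=> ->; [left|right]; first by apply/pointsP; exists p.
by apply/imfsetP; exists (lab p) => //; apply/pointsP; exists p.
Qed.

Lemma shiftable_of_partitions (P T : finType) (k r v : nat)
    (f : 'I_r -> P -> T) (lab : P -> int) :
  #|P| = v -> injective (fun p => `|lab p|%N) ->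
  (forall p, 0 < `|lab p|%N <= v) ->
  orthogonal_partitions k f -> 1 < k -> 0 < #|T| -> 0 < r ->
  (forall c t, \sum_(p | f c p == t) lab p = 0)%R ->
  (forall c t, \sum_(p | f c p == t) sgz (lab p) = 0)%R ->
  shiftable_heffter_space v k r (points lab) (blocks f lab).
Proof.
move=> card_P abs_inj abs_bd f_orth k_gt1 T_gt0 r_gt0 sum0 sg0.
have lab_inj : injective lab by move=> p q e; apply: abs_inj; rewrite e.
(* A nonzero x satisfies 2 [x > 0] = 1 + sgn x; summing over a block turns [sg0] into the count of
   positive entries. The doubled form also yields that [k] is even. *)
have pos c t : (#|` [fset x in block f lab c t | (0 < x)%R]|).*2 = k.
  rewrite card_fset_sum1 big_fset /= big_mkcond big_imfset_finType //=.
  have <- : \sum_(p | f c p == t) 1 = k by rewrite -(f_orth.1 c t) -sum1_card.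
  apply/eqP; rewrite -eqz_nat -mul2n PoszM; apply/eqP.
  rewrite -!natz !natr_sum mulr_sumr -[RHS]addr0.
  rewrite -[X in _ = (_ + X)%R](sg0 c t) -big_split /=.
  apply: eq_bigr => p _; have := abs_bd p.
  by case: sgzP => //=; lia.
split.
- split.
  + by rewrite -card_P; exact: (space_of_partitions lab_inj f_orth).
  + by apply: (half_set_of_abs_inj card_P).
  + by move=> _ /blocksP[c [t ->]]; rewrite big_imfset_finType /= ?sum0.
- by have /card_gt0P[t _] := T_gt0; rewrite -(pos (Ordinal r_gt0) t) odd_double.
- by move=> _ /blocksP[c [t ->]]; rewrite -(pos c t) doubleK.
Qed.

(** * Products of partitions with shifted labels *)

Section Product.
Variables (A S Q U : finType) (k m r : nat).
Variables (g : 'I_r -> A -> S) (o : 'I_r -> Q -> U).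

Definition prod_partitions (c : 'I_r) (p : A * Q) : S * U := (g c p.1, o c p.2).

Lemma orthogonal_prod :
  orthogonal_partitions k g -> orthogonal_partitions m o ->
  orthogonal_partitions (k * m) prod_partitions.
Proof.
move=> g_orth o_orth; split=> [c [s u]|c d neq_cd [a q] [a' q']].
  rewrite -(g_orth.1 c s) -(o_orth.1 c u) -cardX.
  by apply: eq_card => p; rewrite !inE xpair_eqE.
case=> eg eo eg' eo'; congr pair.
  by apply: (g_orth.2 _ _ neq_cd); rewrite eg eg'.
by apply: (o_orth.2 _ _ neq_cd); rewrite eo eo'.
Qed.

Variables (h : A -> int) (w : Q -> nat) (N M : nat).

Definition shift_label (p : A * Q) : int :=
  (h p.1 + sgz (h p.1) * (N * w p.2)%N%:Z)%R.

Lemma sgz_shift_label p : sgz (shift_label p) = sgz (h p.1).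
Proof.
rewrite /shift_label; move: (N * _)%N => x.
by case: (sgzP (h p.1)) => hp; [rewrite hp|apply: gtr0_sgz|apply: ltr0_sgz]; lia.
Qed.

Lemma abs_shift_label p : h p.1 != 0%R ->
  `|shift_label p|%N = (`|h p.1| + N * w p.2)%N.
Proof. rewrite /shift_label; move: (N * _)%N => x; case: sgzP; lia. Qed.

(* The balance of signs in each block of the first factor makes the labelling
   [w] of the second factor irrelevant: any bijection onto an initial segment
   will do. *)
Lemma shiftable_product :
  #|A| = N -> #|Q| = M ->
  injective (fun a => `|h a|%N) -> (forall a, 0 < `|h a|%N <= N) ->
  injective w -> (forall q, w q < M) ->
  orthogonal_partitions k g -> orthogonal_partitions m o ->
  1 < k -> 0 < m -> 0 < #|S| -> 0 < #|U| -> 0 < r ->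
  (forall c s, \sum_(a | g c a == s) h a = 0)%R ->
  (forall c s, \sum_(a | g c a == s) sgz (h a) = 0)%R ->
  shiftable_heffter_space (N * M) (k * m) r
    (points shift_label) (blocks prod_partitions shift_label).
Proof.
move=> card_A card_Q h_inj h_bd w_inj w_bd g_orth o_orth.
move=> k_gt1 m_gt0 S_gt0 U_gt0 r_gt0 sum0 sg0.
have h_neq0 a : h a != 0%R by have := h_bd a; lia.
apply: shiftable_of_partitions => //.
- by rewrite card_prod card_A card_Q.
- move=> [a q] [b q']; rewrite !abs_shift_label //= => e.
  have A_gt0 : 0 < N by have := h_bd a; lia.
  (* Lowered by one, the absolute values of [h] lie below [N], so quotient and remainder by [N]
     recover the two factors. *)
  have {}e : N * w q + `|h a|.-1 = N * w q' + `|h b|.-1.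
    by have := h_bd a; have := h_bd b; lia.
  have ltA x : `|h x|.-1 < N by have := h_bd x; lia.
  have := congr1 (divn^~ N) e; have := congr1 (modn^~ N) e.
  rewrite ![N * _]mulnC !modnMDl !modn_small // !divnMDl // !divn_small //.
  rewrite !addn0 => eh /w_inj->; congr pair; apply: h_inj.
  by have := h_bd a; have := h_bd b; lia.
- move=> [a q]; rewrite abs_shift_label //=; have := h_bd a; have := w_bd q; nia.
- exact: orthogonal_prod.
- by apply: leq_trans k_gt1 _; rewrite leq_pmulr.
- by rewrite card_prod muln_gt0 S_gt0.
- move=> c [s u].
  rewrite (eq_bigl (fun p => (g c p.1 == s) && (o c p.2 == u))); last first.
    by move=> p; rewrite xpair_eqE.
  (* For fixed [q] the terms [h a] cancel by [sum0], and the shifts, equal up to sign, cancel by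
     [sg0]. *)
  rewrite /shift_label big_split /=.
  rewrite -(pair_big (fun a => g c a == s) (fun q => o c q == u) (fun a _ => h a)).
  rewrite -(pair_big (fun a => g c a == s) (fun q => o c q == u)
    (fun a q => sgz (h a) * (N * w q)%N%:Z)%R) /=.
  rewrite exchange_big /= big1 => [|q _]; last exact: sum0.
  by rewrite exchange_big /= big1 ?addr0 // => q _; rewrite -mulr_suml sg0 mul0r.
- move=> c [s u].
  rewrite (eq_bigl (fun p => (g c p.1 == s) && (o c p.2 == u))); last first.
    by move=> p; rewrite xpair_eqE.
  under eq_bigr do rewrite sgz_shift_label.
  rewrite -(pair_big (fun a => g c a == s) (fun q => o c q == u)
    (fun a _ => sgz (h a))).
  by rewrite exchange_big /= big1 // => q _; exact: sg0.
Qed.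

End Product.

(** * Orthogonal triples on rectangular grids *)

(** Both quotients by [d] are 0 or 1. This replaces congruences by linear alternatives within reach
    of [lia]. *)
Lemma eqmod_lt_double (d a b : nat) : a < d.*2 -> b < d.*2 -> a = b %[mod d] ->
  [\/ a = b, a = b + d | b = a + d].
Proof.
move=> a_lt b_lt e.
have := divn_eq a d; have := divn_eq b d; rewrite e.
have : a %/ d < 2 by rewrite ltn_divLR; lia.
have : b %/ d < 2 by rewrite ltn_divLR; lia.
case: (a %/ d) => [|[|//]]; case: (b %/ d) => [|[|//]] _ _ ea eb;
  [constructor 1|constructor 3|constructor 2|constructor 1]; lia.
Qed.

Section Grids.
Variables (m n : nat) (m_gt0 : 0 < m).

Definition mod_ord (x : nat) : 'I_m := Ordinal (ltn_pmod x m_gt0).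

(** Used twice: for square grids, and with [m] equal to 4 for the rows, columns and cyclic diagonals
    of the array. *)
Definition latin_partitions (c : 'I_3) (p : 'I_m * 'I_m) : 'I_m :=
  match nat_of_ord c with 0 => p.1 | 1 => p.2 | _ => mod_ord (p.1 + p.2) end.

Lemma latin_orthogonal : orthogonal_partitions m latin_partitions.
Proof.
have inj : forall c d, c != d ->
    injective (fun p => (latin_partitions c p, latin_partitions d p)).
  apply: injective_pair_sym => -[[|[|[|//]]] ?] [[|[|[|//]]] ?] //= _;
    rewrite /latin_partitions /=.
  - by move=> [i j] [i' j'] [] /= -> ->.
  - move=> [i j] [i' j'] /= [-> /eqP]; rewrite eqn_modDl !modn_small //.
    by move=> /eqP/val_inj->.
  - move=> [i j] [i' j'] /= [-> /eqP]; rewrite eqn_modDr !modn_small //.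
    by move=> /eqP/val_inj->.
split=> // c t.
(* Paired with any other partition [d], partition [c] gives an injection of the grid into a set of
   equal size, hence a bijection. It carries the part named [t] onto the pairs with first entry [t],
   of which there are [m]. *)
have [d neq_cd] : exists d, c != d.
  by exists (if c == ord0 then ord_max else ord0); case: c => [[|[|[|//]]] ?].
have bij := inj_card_bij (inj c d neq_cd) (leqnn _).
transitivity (\sum_(z : 'I_m * 'I_m | (z.1 == t) && true) 1).
  rewrite -sum1_card [RHS](reindex _ (onW_bij _ bij)) /=.
  by apply: eq_bigl => p; rewrite andbT.
rewrite -(pair_big (fun i => i == t) xpredT (fun _ _ => 1)) /= big_pred1_eq.
by rewrite sum1_card card_ord.
Qed.

Definition skip (j : nat) : nat := j + (~~ odd m && (m./2.-1 <= j)).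

Lemma skip_lt j : j < m.-1 -> skip j < m.
Proof. by rewrite /skip; case: (_ && _); lia. Qed.

(** Subtracting the congruences leaves [j + skip j] modulo [m]. For odd [m] this is 2j, and 2 is
    invertible. For even [m] its parity tells whether j lies before or after the skip, and each of
    these ranges has at most m/2 consecutive values, so no residue repeats. *)
Lemma skew_meet i i' j j' : i < m -> i' < m -> j < m.-1 -> j' < m.-1 ->
  i + skip j = i' + skip j' %[mod m] -> i + (m - j) = i' + (m - j') %[mod m] ->
  i = i' /\ j = j'.
Proof.
move=> lt_im lt_i'm lt_jm lt_j'm.
have lt_s := skip_lt lt_jm; have lt_s' := skip_lt lt_j'm.
have [b1 b1'] : i + skip j < m.*2 /\ i' + skip j' < m.*2 by lia.
have [b2 b2'] : i + (m - j) < m.*2 /\ i' + (m - j') < m.*2 by lia.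
move=> /(eqmod_lt_double b1 b1') e1 /(eqmod_lt_double b2 b2') e2; move: e1 e2.
have := odd_double_half m; rewrite /skip; set h := m./2; clearbody h.
case: (odd m) => /= mE.
  by case=> ?; case=> ?; lia.
by do 2 case: leqP => ? /=; case=> ?; case=> ?; lia.
Qed.

(* The natural choice is the three slopes [i], [i + j], [i - j] over Z/m, but for
   even m the last two meet twice in positions differing by m/2. Skipping the
   value m/2 - 1 in the second slope turns their difference [2 j] into
   [2 j + 1] from there on, which keeps it injective modulo m for j < m - 1. *)
Definition skew_partitions (c : 'I_3) (p : 'I_m * 'I_n) : 'I_m :=
  match nat_of_ord c with
  | 0 => p.1
  | 1 => mod_ord (p.1 + skip p.2)
  | _ => mod_ord (p.1 + (m - p.2))
  end.

Lemma skew_orthogonal : n < m -> orthogonal_partitions n skew_partitions.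
Proof.
move=> lt_nm; split=> [c t|].
  (* For fixed [j] each of the three maps is a translation of Z/m, so every part has exactly one
     point with second coordinate [j], and [n] points in all. *)
  have bij j : bijective (fun i => skew_partitions c (i, j)).
    apply: injF_bij; case: c => [[|[|[|//]]] ?] i i' //= [/eqP];
    by rewrite eqn_modDr !modn_small // => /eqP/val_inj.
  rewrite -sum1_card big_mkcond /=.
  rewrite -(pair_bigA _ (fun i j => if skew_partitions c (i, j) == t then 1 else 0)).
  rewrite exchange_big /= (eq_bigr (fun=> 1)) ?sum1_card ?card_ord // => j _.
  rewrite -big_mkcond -[RHS](big_pred1_eq addn t (fun=> 1)).
  by rewrite [RHS](reindex _ (onW_bij _ (bij j))).
have lt_jm (j : 'I_n) : j < m.-1 by have := ltn_ord j; lia.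
have skip_ltm (j : 'I_n) : skip j < m := skip_lt (lt_jm j).
have skip_inj (j j' : 'I_n) : skip j = skip j' -> j = j'.
  by move=> e; apply: val_inj; move: e; rewrite /skip /=; lia.
apply: injective_pair_sym => -[[|[|[|//]]] ?] [[|[|[|//]]] ?] //= _;
    rewrite /skew_partitions /=.
- move=> [i j] [i' j'] /= [-> /eqP]; rewrite eqn_modDl !modn_small //.
  by move=> /eqP/skip_inj ->.
- move=> [i j] [i' j'] /= [-> /eqP]; rewrite eqn_modDl => /eqP.
  have := ltn_ord j; have := ltn_ord j' => ? ?.
  by case/eqmod_lt_double => [||e|e|e]; try lia; congr pair; apply: val_inj => /=; lia.
- move=> [i j] [i' j'] [] /= e1 e2.
  have [ei ej] := skew_meet (ltn_ord i) (ltn_ord i') (lt_jm j) (lt_jm j') e1 e2.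
  by congr pair; exact: val_inj.
Qed.

End Grids.

(** Fixing the second coordinate gives parts of [m] points, which is the right size only for
    [n = m]; the skew slopes need [n < m] to leave room for the skipped value. *)
Lemma exists_orthogonal_triple (m n : nat) : 0 < m -> n <= m ->
  exists o : 'I_3 -> 'I_m * 'I_n -> 'I_m, orthogonal_partitions n o.
Proof.
move=> m_gt0; rewrite leq_eqVlt => /orP[/eqP->|lt_nm].
  by exists (latin_partitions m_gt0); exact: latin_orthogonal.
by exists (skew_partitions m_gt0); exact: skew_orthogonal.
Qed.

(** * The array of order 4 and the final construction *)

(* Found by computer search. *)
Definition magic_square : seq (seq int) :=
  [:: [:: 1; -2; -7; 8];
      [:: -11; 3; 13; -5];
      [:: 16; -15; -10; 9];
      [:: -6; 14; 4; -12]]%Z.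

Definition magic_entry (p : 'I_4 * 'I_4) : int :=
  nth 0%R (nth [::] magic_square p.1) p.2.

Lemma magic_entry_bounds p : 0 < `|magic_entry p|%N <= 16.
Proof. by case: p => [[[|[|[|[|//]]]] ?] [[|[|[|[|//]]]] ?]]. Qed.

Lemma magic_entry_inj : injective (fun p => `|magic_entry p|%N).
Proof.
move=> [[[|[|[|[|//]]]] ?] [[|[|[|[|//]]]] ?]] [[[|[|[|[|//]]]] ?] [[|[|[|[|//]]]] ?]] //= _.
all: by congr pair; exact: val_inj.
Qed.

Lemma magic_sums (m_gt0 : 0 < 4) (c : 'I_3) (t : 'I_4) :
  (\sum_(p | latin_partitions m_gt0 c p == t) magic_entry p = 0)%R /\
  (\sum_(p | latin_partitions m_gt0 c p == t) sgz (magic_entry p) = 0)%R.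
Proof.
pose cell (h : 'I_4 * 'I_4 -> int) i j :=
  if latin_partitions m_gt0 c (i, j) == t then h (i, j) else 0%R.
have expand h : (\sum_(p | latin_partitions m_gt0 c p == t) h p =
    \sum_i \sum_j cell h i j)%R.
  by rewrite pair_bigA big_mkcond; apply: eq_bigr => -[].
(* With the sums unrolled over explicit ordinals, each of the twelve pairs [(c, t)] is settled by
   evaluation. *)
rewrite !expand !big_ord_recl !big_ord0 /cell.
clear cell expand; case: c t => [[|[|[|//]]] ?] [[|[|[|[|//]]]] ?]; split; by [].
Qed.

Theorem theorem3p9 (l m n : nat) (hl : 0 < l) (hm : 0 < m) (hn : 0 < n)
    (hmn : n <= m) :
  exists (V : {fset int}) (B : {fset {fset int}}),
    shiftable_heffter_space (16 * l ^ 2 * m * n) (4 * l * n) 3 V B.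
Proof.
have four_gt0 : 0 < 4 by [].
have lm_gt0 : 0 < l * m by rewrite muln_gt0 hl.
have ln_le : l * n <= l * m by rewrite leq_mul.
have [o o_orth] := exists_orthogonal_triple lm_gt0 ln_le.
pose w (q : 'I_(l * m) * 'I_(l * n)) := val (enum_rank q).
exists (points (shift_label magic_entry w 16)).
exists (blocks (prod_partitions (latin_partitions four_gt0) o)
  (shift_label magic_entry w 16)).
have -> : 16 * l ^ 2 * m * n = 16 * (l * m * (l * n)) by lia.
rewrite -(mulnA 4); apply: shiftable_product => //.
- by rewrite card_prod !card_ord.
- by rewrite card_prod !card_ord.
- exact: magic_entry_inj.
- exact: magic_entry_bounds.
- by move=> q q' /val_inj/enum_rank_inj.
- by move=> q; rewrite (leq_trans (ltn_ord _)) // card_prod !card_ord.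
- exact: latin_orthogonal.
- by rewrite muln_gt0 hl.
- by rewrite card_ord.
- by rewrite card_ord.
- by move=> c s; case: (magic_sums four_gt0 c s).
- by move=> c s; case: (magic_sums four_gt0 c s).
Qed.
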